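(* Let $p\in\mathbb{N}_0$, $t>0$, and let $A,v,\beta,V_m,H_m,h_{m+1,m}$ be as in the context (exact Arnoldi decomposition), with $\mu_2(A)\le 0$. Write the eigenvalues of $H_m$ (counted with algebraic multiplicity) as $\lambda_j=\xi_j+\mathrm{i}\eta_j$ with $\xi_j,\eta_j\in\mathbb{R}$, $j=1,\dots,m$, and let $\gamma_m=\prod_{j=1}^{m-1}(H_m)_{j+1,j}$. Then the error $l_{p,m}(t)=\beta V_m\varphi_p(tH_m)e_1-\varphi_p(tA)v$ of the Krylov propagator satisfies $$\|l_{p,m}(t)\|_2\le \beta\, h_{m+1,m}\,\gamma_m\, t\,(\varphi_{p+1})_t[\xi_1,\dots,\xi_m].$$
   Context: For $p\in\mathbb{N}_0$, $\varphi_p(z)=\sum_{k=0}^\infty \frac{z^k}{(k+p)!}$ ($\varphi_0=\exp$), and $\varphi_p$ of a square matrix is defined by the same power series. For a function $f$ and $t\in\mathbb{R}$, $f_t$ denotes the function $\lambda\mapsto f(t\lambda)$, and $f_t[\lambda_1,\dots,\lambda_m]$ its divided difference over the nodes $\lambda_1,\dots,\lambda_m$ (in the confluent sense for repeated nodes). $e_j$ is the $j$-th unit vector. The logarithmic norm is $\mu_2(A)=\max\,\mathrm{spec}\big((A+A^* )/2\big)$, i.e. the maximal real part of the numerical range of $A$. Setting: $A\in\mathbb{C}^{n\times n}$, $0\ne v\in\mathbb{C}^n$, $\beta=\|v\|_2$. The Arnoldi method (exact arithmetic, no breakdown) for the Krylov subspace $\mathrm{span}(v,Av,\dots,A^{m-1}v)$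 yields $V_m\in\mathbb{C}^{n\times m}$ with orthonormal columns spanning this subspace, $\beta V_me_1=v$, an upper Hessenberg matrix $H_m=V_m^*AV_m\in\mathbb{C}^{m\times m}$ with real positive lower subdiagonal entries, a number $h_{m+1,m}>0$ and a unit vector $v_{m+1}\in\mathbb{C}^n$ with $V_m^*v_{m+1}=0$, such that $$AV_m=V_mH_m+h_{m+1,m}v_{m+1}e_m^*.$$ *)

(* Defs.v *)
From HB Require Import structures.
From mathcomp Require Import all_boot all_order all_algebra.
From mathcomp Require Import complex.
From mathcomp Require Import all_classical all_reals all_analysis.

Set Implicit Arguments.
Unset Strict Implicit.
Unset Printing Implicit Defensive.

Import Order.TTheory GRing.Theory Num.Theory.
Import numFieldNormedType.Exports.

Local Open Scope classical_set_scope.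
Local Open Scope ring_scope.
Local Open Scope complex_scope.
Local Open Scope sesquilinear_scope.

Definition phi (K : numFieldType) (p : nat) (z : K) : K :=
  lim (series (fun k => z ^+ k / ((k + p)`!)%:R) @ \oo).

Definition phi_mx (K : numFieldType) (n p : nat) (M : 'M[K]_n) : 'M[K]_n :=
  lim (series (fun k => (((k + p)`!)%:R)^-1 *: M ^+ k) @ \oo).

(* [divdiff_rec f x k i] is f[x_i, ..., x_(i+k)] for nodes x_i <= ... <= x_(i+k):
   by monotonicity x_i = x_(i+k) means that the k+1 nodes all coincide, in which
   case the value is the confluent one, f^(k)(x_i) / k!. This includes
   f[x_i] = f x_i, so the value 0 below is never reached. *)
Fixpoint divdiff_rec (R : realType) (f : R -> R) (x : nat -> R) (k i : nat) : R :=
  if x i == x (i + k)%N then derive1n k f (x i) / (k`!)%:R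
  else if k is k'.+1 then
    (divdiff_rec f x k' i.+1 - divdiff_rec f x k' i) / (x (i + k)%N - x i)
  else 0.

(* Divided differences are symmetric in the nodes; sorting makes repeated nodes
   adjacent, as [divdiff_rec] requires. Only meaningful for [s] nonempty. *)
Definition divdiff (R : realType) (f : R -> R) (s : seq R) : R :=
  divdiff_rec f (nth 0 (sort <=%R s)) (size s).-1 0.

Definition norm2 (R : realType) (n : nat) (u : 'cV[R[i]]_n) : R :=
  Num.sqrt (\sum_i (complex.Re (u i 0) ^+ 2 + complex.Im (u i 0) ^+ 2)).

(* The spectrum of a Hermitian matrix is real, finite, and nonempty if 0 < n, so
   this supremum is then a maximum. *)
Definition log_norm2 (R : realType) (n : nat) (A : 'M[R[i]]_n) : R :=
  sup [set x : R | eigenvalue (2%:R^-1 *: (A + A ^t*)) x%:C].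

Definition krylov_mx (R : realType) (n m : nat) (A : 'M[R[i]]_n) (v : 'cV[R[i]]_n)
    : 'M[R[i]]_(n, m) :=
  \matrix_(i, j) (A ^+ j *m v) i 0.

(* The dimension of the Krylov subspace is m.+1, so the vectors e_1 and e_m of
   the usual 1-based notation are [delta_mx 0 0] and [delta_mx ord_max 0]. The
   order on R[i] makes [0 < z] mean that z is real and positive. *)
Record arnoldi_decomposition (R : realType) (n m : nat)
    (A : 'M[R[i]]_n) (v : 'cV[R[i]]_n)
    (V : 'M[R[i]]_(n, m.+1)) (H : 'M[R[i]]_(m.+1))
    (h : R) (w : 'cV[R[i]]_n) : Prop := ArnoldiDecomposition {
  arnoldi_orthonormal : V ^t* *m V = 1%:M;
  arnoldi_span : (V^T == (krylov_mx m.+1 A v)^T)%MS;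
  arnoldi_start : (norm2 v)%:C *: (V *m delta_mx 0 0) = v;
  arnoldi_proj : H = V ^t* *m A *m V;
  arnoldi_hessenberg : forall i j : 'I_m.+1, (j.+1 < i)%N -> H i j = 0;
  arnoldi_subdiag : forall i j : 'I_m.+1, i = j.+1 :> nat -> 0 < H i j;
  arnoldi_next_gt0 : 0 < h;
  arnoldi_next_unit : norm2 w = 1;
  arnoldi_next_orthogonal : V ^t* *m w = 0;
  arnoldi_relation :
    A *m V = V *m H + h%:C *: (w *m (delta_mx ord_max 0 : 'cV_m.+1) ^t*)
}.

(* The subdiagonal entries are real in an Arnoldi decomposition, so taking the
   real part is then only a change of type. *)
Definition subdiag_prod (R : realType) (m : nat) (H : 'M[R[i]]_(m.+1)) : R :=
  complex.Re (\prod_(j < m) H (lift ord0 j) (widen_ord (leqnSn m) j)).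

(* Main.v *)
(* Put beta = norm2 v, gamma = subdiag_prod H and let h, w, lambda be as in the
   theorem. By the Arnoldi relation the scaled error L(s) = s^p l_{p,m}(s) solves
   L' = A L - beta h gamma g w with L(0) = 0, where
   g(s) = s^p (phi_p)_s[lambda_1, ..., lambda_m]: the corner entry of H^k is gamma
   times the divided difference of x^k over the eigenvalues, because H is
   Hessenberg and satisfies its characteristic polynomial. As A is dissipative,
   norm2 (L s) is at most beta h gamma times the integral of |g|.
   Since phi_p(z) is the divided difference of exp over z and p zeros, g is the
   divided difference of x |-> exp (s x) over p zeros and the lambda_j. Divided
   differences of exp satisfy g' = lambda g + g_0, with g_0 the one over the list
   without the node lambda, so by induction on the list |g| is at most the same
   divided difference with every node replaced by its real part. Prepending one
   more zero integrates in s, which turns phi_p into phi_{p+1}.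
   All functions are treated as exponential generating functions: differentiation
   is then a shift of the sequence, and prepending zero nodes a delay. *)

Require Import Defs.
From HB Require Import structures.
From mathcomp Require Import all_boot all_order all_algebra.
From mathcomp Require Import complex.
From mathcomp Require Import all_classical all_reals all_analysis.
From mathcomp Require Import ring lra.

Set Implicit Arguments.
Unset Strict Implicit.
Unset Printing Implicit Defensive.

Import Order.TTheory GRing.Theory Num.Theory.
Import numFieldNormedType.Exports.

Local Open Scope classical_set_scope.
Local Open Scope ring_scope.
Local Open Scope complex_scope.
Local Open Scope sesquilinear_scope.

(** * Divided differences of powers and Hessenberg matrices *)

(* [powdd s k] is the divided difference of [x ^+ k] over the nodes [s],
   repeated or not; the recursion is the Leibniz rule for [x * x ^+ k]. The value
   0 on the empty list makes that rule hold for a single node too. *)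
Fixpoint powdd (K : nzRingType) (s : seq K) : nat -> K :=
  if s is a :: s' then
    fix pw k := if k is k'.+1 then a * pw k' + powdd s' k' else (nilp s')%:R
  else fun=> 0.

Section PowDD.
Variable K : comNzRingType.
Implicit Types (a b : K) (s : seq K).

Lemma powdd_nil k : powdd [::] k = 0 :> K. Proof. by []. Qed.

Lemma powdd_cons0 a s : powdd (a :: s) 0 = (nilp s)%:R. Proof. by []. Qed.

Lemma powdd_consS a s k :
  powdd (a :: s) k.+1 = a * powdd (a :: s) k + powdd s k.
Proof. by []. Qed.

Lemma powdd_0 s : powdd s 0 = (size s == 1)%:R.
Proof. by case: s. Qed.

Lemma powdd_lt s k : (k.+1 < size s)%N -> powdd s k = 0.
Proof.
elim: k s => [|k IHk] [|a [|b s]] // lt_k_s; rewrite powdd_consS !IHk //.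
  by rewrite mulr0 addr0.
exact: ltnW.
Qed.

Lemma powdd_cons_zero a s k : powdd [:: 0, a & s] k.+1 = powdd (a :: s) k.
Proof. by rewrite powdd_consS mul0r add0r. Qed.

(** For a zero node the Leibniz rule keeps only its second term, so each zero shifts the index by
    one. *)
Lemma powdd_nseq0 p a s k :
  powdd (nseq p 0 ++ a :: s) (k + p) = powdd (a :: s) k.
Proof.
elim: p => [|p IHp]; first by rewrite addn0.
rewrite addnS -[RHS]IHp; case: p {IHp} => [|p] /=; exact: powdd_cons_zero.
Qed.

Lemma powdd_nseq0_lt p a s k : (k < p)%N -> powdd (nseq p 0 ++ a :: s) k = 0.
Proof.
move=> lt_kp; apply: powdd_lt; rewrite size_cat size_nseq /=.
by rewrite addnS ltnS ltn_addr.
Qed.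

(** The Leibniz rule peels the last node as well as the first, because the two peelings commute;
    this is the part of the symmetry in the nodes that [powdd_ends] needs. *)
Lemma powdd_rconsS s b k :
  powdd (rcons s b) k.+1 = b * powdd (rcons s b) k + powdd s k.
Proof.
elim: k s => [|k IHk] [|a s]; rewrite ?powdd_nil //.
  rewrite rcons_cons powdd_consS !powdd_0 /= size_rcons !eqSS.
  by rewrite !mulr0 !add0r.
have e := powdd_consS a (rcons s b) k; rewrite -rcons_cons in e.
rewrite (powdd_consS a s) e rcons_cons powdd_consS -rcons_cons !IHk.
by ring.
Qed.

(** Peeling either end node off the same value at [k.+1] and comparing gives the quotient recursion
    of divided differences, which ties [powdd] to [divdiff_rec]. *)
Lemma powdd_ends a s b k :
  (b - a) * powdd (a :: rcons s b) k = powdd (rcons s b) k - powdd (a :: s) k.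
Proof.
have := powdd_rconsS (a :: s) b k; rewrite rcons_cons powdd_consS => e.
by rewrite mulrBl -[b * _](addrK (powdd (a :: s) k)) -e; ring.
Qed.

(** The confluent case, by Pascal's rule: the right side is the k-th derivative of x^(j+k) at [a],
    divided by k!. *)
Lemma powdd_nseq a k j : powdd (nseq k.+1 a) (j + k) = a ^+ j *+ 'C(j + k, k).
Proof.
elim: k j => [|k IHk] j; elim: j => [|j IHj].
- by [].
- move: IHj; rewrite !addn0 => IHj.
  by rewrite powdd_consS IHj !bin0 addr0 exprS.
- rewrite add0n powdd_consS (@powdd_lt (a :: _)) /= ?size_nseq // mulr0 add0r.
  by have := IHk 0%N; rewrite !add0n !binn.
rewrite addSn powdd_consS IHj mulrnAr -exprS binS mulrnDr; congr (_ + _).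
by rewrite -addSnnS IHk.
Qed.

End PowDD.

Section Hessenberg.
Variables (K : comNzRingType) (m : nat) (H : 'M[K]_m.+1).
Hypothesis hessH : forall i j : 'I_m.+1, (j.+1 < i)%N -> H i j = 0.

(** Each Hessenberg factor moves the support of the first column down by at most one row, and the
    lowest entry then picks up one subdiagonal entry of [H]. *)
Lemma hessenberg_prod_col0 (s : seq K) (i : 'I_m.+1) : (size s <= i)%N ->
  (\prod_(a <- s) (H - a%:M)) i 0 =
  (size s == i)%:R *
  \prod_(j < m | (j < size s)%N) H (lift ord0 j) (widen_ord (leqnSn m) j).
Proof.
elim: s i => [|a s IHs] i /= le_s_i.
  by rewrite big_nil !mxE big_pred0 // mulr1 -val_eqE /= eq_sym.
rewrite big_cons mxE.
have lt_s_m : (size s < m)%N by apply: leq_trans le_s_i _; rewrite -ltnS.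
(* Row [size s] gives the only surviving term: below it the inductive product vanishes, above it the
   Hessenberg factor does. *)
pose k := widen_ord (leqnSn m) (Ordinal lt_s_m).
have offdiag (j : 'I_m.+1) : (j < i)%N -> (H - a%:M) i j = H i j.
  by move=> lt_ji; rewrite !mxE -val_eqE /= gtn_eqF ?mulr0n ?subr0.
rewrite (bigD1 k) //= [X in _ + X]big1 ?addr0 => [|j neq_jk]; last first.
  have [lt_sj|] := ltnP (size s) j.
    by rewrite IHs ?(ltnW lt_sj) // ltn_eqF ?mul0r ?mulr0.
  rewrite leq_eqVlt => /orP[/eqP eq_js|lt_js].
    by case/eqP: neq_jk; apply: val_inj.
  have lt_ji : (j.+1 < i)%N by apply: leq_trans le_s_i.
  by rewrite offdiag ?hessH ?mul0r // ltnW.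
rewrite offdiag // IHs // eqxx mul1r.
have [eq_si|neq_si] := eqVneq (size s).+1 i; last first.
  by rewrite hessH ?mul0r // ltn_neqAle neq_si.
rewrite mul1r [RHS](bigD1 (Ordinal lt_s_m)) //=; congr (H _ _ * _).
  by apply: val_inj; rewrite /= -eq_si.
by apply: eq_bigl => j; rewrite -val_eqE /= ltnS ltn_neqAle andbC.
Qed.

(** Writing [H] as [a%:M] plus [H - a%:M] reproduces the Leibniz rule that defines [powdd]. *)
Lemma hessenberg_expr_corner (s : seq K) k :
  char_poly H = \prod_(a <- s) ('X - a%:P) ->
  (H ^+ k) ord_max 0 =
  (\prod_(j < m) H (lift ord0 j) (widen_ord (leqnSn m) j)) * powdd s k.
Proof.
move=> charH.
have size_s : size s = m.+1.
  by apply/succn_inj; rewrite -(size_prod_XsubC _ id) -charH size_char_poly.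
(* The nodes already used as factors are collected in [r]. Once [s'] is empty, Cayley-Hamilton makes
   the left side vanish, in agreement with [powdd [::]]. *)
suff corner r s' : r ++ s' = s -> forall k,
    (\prod_(a <- r) (H - a%:M) * H ^+ k) ord_max 0 =
    (\prod_(j < m) H (lift ord0 j) (widen_ord (leqnSn m) j)) * powdd s' k.
  by rewrite -(corner [::] s) // big_nil mul1r.
elim: s' r => [|a s' IHs'] r def_s k'.
  rewrite powdd_nil mulr0; have := Cayley_Hamilton H.
  rewrite charH rmorph_prod /= -def_s cats0.
  under eq_bigr do rewrite rmorphB /= horner_mx_X horner_mx_C.
  by move->; rewrite mul0r mxE.
have {}IHs' := IHs' (rcons r a); rewrite cat_rcons in IHs'.
elim: k' => [|k' IHk'].
  rewrite expr0 mulr1 powdd_cons0.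
  have size_r : (size r + size s' = m)%N.
    by apply/succn_inj; rewrite -addnS -size_s -def_s size_cat.
  have le_rm : (size r <= m)%N by rewrite -size_r leq_addr.
  (* With no power of [H] left, exactly [m] factors are needed to reach the corner, that is, [a]
     must be the last node. *)
  rewrite hessenberg_prod_col0 // mulrC /=.
  have -> : nilp s' = (size r == m).
    by rewrite -size_r -[X in X == _]addn0 eqn_add2l eq_sym.
  case: eqP => [eq_rm|_]; last by rewrite !mulr0.
  by congr (_ * _); apply: eq_bigl => j; rewrite eq_rm ltn_ord.
rewrite powdd_consS mulrDr mulrCA -IHk' -IHs' // big_rcons /=.
rewrite mulrBr mulrBl -[_ * H * _]mulrA -exprS.
rewrite [_ * a%:M]mul_mx_scalar -scalerAl.
move: (_ * H ^+ k'.+1) (_ * H ^+ k') => X Y.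
by rewrite !mxE; ring.
Qed.

End Hessenberg.

(** * Comparison with a scalar differential inequality *)

Section Comparison.
Variable R : realType.

(** The sum of [(u * x i - v * y i) ^+ 2] is nonnegative; at [u = S], [v = X] this is Cauchy-Schwarz
    multiplied by [X], hence the separate case [X = 0]. *)
Lemma le_sum_sqrt_cauchy (I : finType) (x y : I -> R) :
  \sum_i x i * y i <=
  Num.sqrt (\sum_i x i ^+ 2) * Num.sqrt (\sum_i y i ^+ 2).
Proof.
set X := \sum_i x i ^+ 2; set Y := \sum_i y i ^+ 2; set S := \sum_i _.
have X0 : 0 <= X by apply: sumr_ge0 => i _; exact: sqr_ge0.
have Y0 : 0 <= Y by apply: sumr_ge0 => i _; exact: sqr_ge0.
have quad (u v : R) : 0 <= u ^+ 2 * X - u * v * S *+ 2 + v ^+ 2 * Y.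
  rewrite /X /Y /S !mulr_sumr -sumrMnl -sumrB -big_split /=.
  by apply: sumr_ge0 => i _; have := sqr_ge0 (u * x i - v * y i); lra.
have [X_eq0|X_neq0] := eqVneq X 0.
  rewrite X_eq0 sqrtr0 mul0r /S big1 // => i _.
  have /eqP := X_eq0; rewrite psumr_eq0 => [/allP/(_ i)|j _]; last first.
    exact: sqr_ge0.
  by rewrite mem_index_enum sqrf_eq0 => /(_ isT)/eqP ->; rewrite mul0r.
have X_gt0 : 0 < X by rewrite lt_def X_neq0.
have le_S2 : S ^+ 2 <= X * Y.
  by rewrite -(ler_pM2l X_gt0); have := quad S X; lra.
rewrite -sqrtrM //; apply: le_trans (ler_norm _) _.
by rewrite -sqrtr_sqr ler_wsqrtr.
Qed.

Lemma le_of_is_derive_le (f g df dg : R -> R) (x : R) :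
  (forall s : R, is_derive s 1 f (df s)) ->
  (forall s : R, is_derive s 1 g (dg s)) ->
  (forall s : R, 0 <= s -> df s <= dg s) -> 0 <= x ->
  f x - f 0 <= g x - g 0.
Proof.
move=> Df Dg le_d x0.
pose h := f - g.
have Dh (s : R) : is_derive s 1 h (df s - dg s) by apply: is_deriveB.
have ch : {within `[0, x], continuous h}.
  apply: continuous_subspaceT => s; apply: differentiable_continuous.
  by apply/derivable1_diffP; have [] := Dh s.
suff : h x <= h 0 by rewrite /h !fctE; lra.
apply: (@ler0_derive1_le_cc R h 0 x _ _ ch); rewrite ?in_itv /= ?lexx ?x0 //.
move=> s; rewrite in_itv /= => /andP[s0 _].
by rewrite derive1E (@derive_val _ _ _ _ _ _ _ (Dh s)) subr_le0 le_d ?ltW.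
Qed.

Lemma is_derive_bigsum (I : Type) (r : seq I) (f df : I -> R -> R) (x : R) :
  (forall i, is_derive x 1 (f i) (df i x)) ->
  is_derive x 1 (fun s => \sum_(i <- r) f i s) (\sum_(i <- r) df i x).
Proof.
move=> Df; elim: r => [|i r IHr].
  rewrite big_nil (_ : (fun _ => _) = cst 0); first exact: is_derive_cst.
  by apply/funext => s; rewrite big_nil.
rewrite big_cons (_ : (fun _ => _) = f i \+ (fun s => \sum_(j <- r) f j s)).
  exact: is_deriveD.
by apply/funext => s; rewrite big_cons.
Qed.

(* [Num.sqrt] is not differentiable at 0: compare the regularized norm
   [Num.sqrt (\sum_i f i s ^+ 2 + e ^+ 2)] with [G] and let [e] tend to 0. *)
Lemma norm_le_of_dissipative (I : finType) (f df : I -> R -> R)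
    (G dG : R -> R) :
  (forall i (s : R), is_derive s 1 (f i) (df i s)) ->
  (forall s : R, is_derive s 1 G (dG s)) ->
  (forall s : R, 0 <= s -> 0 <= dG s) ->
  (forall s : R, 0 <= s ->
    \sum_i f i s * df i s <= Num.sqrt (\sum_i f i s ^+ 2) * dG s) ->
  Num.sqrt (\sum_i f i 0 ^+ 2) <= G 0 ->
  forall s : R, 0 <= s -> Num.sqrt (\sum_i f i s ^+ 2) <= G s.
Proof.
move=> Df DG dG0 diss init s s0.
pose F s := \sum_i f i s ^+ 2.
have F0 r : 0 <= F r by apply: sumr_ge0 => i _; exact: sqr_ge0.
rewrite -/(F s) -/(F 0) in init *.
apply/ler_addgt0Pr => e e0.
have e20 : 0 < e ^+ 2 by rewrite exprn_gt0.
pose Fe := fun r => F r + e ^+ 2.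
pose psi := Num.sqrt \o Fe.
have Fe0 r : 0 < Fe r by rewrite /Fe; have := F0 r; lra.
have DF (r : R) : is_derive r 1 F (2 * \sum_i f i r * df i r).
  rewrite mulr_sumr.
  apply: (@is_derive_bigsum _ _ (fun i s => f i s ^+ 2)
    (fun i s => 2 * (f i s * df i s))) => i.
  apply: (is_derive_eq (is_deriveM (Df i r) (Df i r))).
  by rewrite /GRing.scale /= mulr_natl mulr2n.
have Dpsi (r : R) : is_derive r 1 psi
   ((2 * Num.sqrt (Fe r))^-1 * (2 * \sum_i f i r * df i r)).
  apply: is_derive1_comp; first exact: is_derive1_sqrt.
  apply: (is_derive_eq (is_deriveD (DF r) (is_derive_cst _ _ _))).
  by rewrite addr0.
have le_psi : psi s - psi 0 <= G s - G 0.
  apply: (le_of_is_derive_le Dpsi DG) => // r r0.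
  (* The derivative of [psi] is the sum of the [f i r * df i r] over [Num.sqrt (Fe r)]; as
     [F r <= Fe r] and [0 <= dG r], it is at most [dG r]. *)
  rewrite ler_pdivrMl ?mulr_gt0 ?sqrtr_gt0 //.
  rewrite -mulrA ler_pM2l // (le_trans (diss r r0)) //.
  by rewrite ler_wpM2r ?dG0 // ler_wsqrtr // /Fe lerDl ltW.
have psi0 : psi 0 <= Num.sqrt (F 0) + e.
  rewrite -(@ler_sqr R) ?nnegrE ?addr_ge0 ?sqrtr_ge0 ?(ltW e0) //.
  rewrite /psi /= sqr_sqrtr ?(ltW (Fe0 0)) // sqrrD sqr_sqrtr // /Fe.
  by have := mulr_ge0 (sqrtr_ge0 (F 0)) (ltW e0); lra.
have : Num.sqrt (F s) <= psi s by rewrite ler_wsqrtr // /Fe lerDl ltW.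
lra.
Qed.

(* The weight [expR (- xi * s)] reduces this to the case [xi = 0]. *)
Lemma norm_le_of_log_growth (xi : R) (I : finType) (f df : I -> R -> R)
    (G g : R -> R) :
  (forall i (s : R), is_derive s 1 (f i) (df i s)) ->
  (forall s : R, is_derive s 1 G (xi * G s + g s)) ->
  (forall s : R, 0 <= s -> 0 <= g s) ->
  (forall s : R, 0 <= s ->
    \sum_i f i s * df i s <=
    xi * (\sum_i f i s ^+ 2) + Num.sqrt (\sum_i f i s ^+ 2) * g s) ->
  Num.sqrt (\sum_i f i 0 ^+ 2) <= G 0 ->
  forall s : R, 0 <= s -> Num.sqrt (\sum_i f i s ^+ 2) <= G s.
Proof.
move=> Df DG g0 diss init s s0.
pose E : R -> R := expR \o ( *%R (- xi)).
have E0 r : 0 < E r by exact: expR_gt0.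
have DE (r : R) : is_derive r 1 E (- xi * E r).
  rewrite mulrC; apply: is_derive1_comp.
  apply: (is_derive_eq (is_deriveZ (- xi) (is_derive_id r 1))).
  by rewrite /GRing.scale /= mulr1.
have DEf h dh (r : R) : is_derive r 1 h dh ->
    is_derive r 1 (E * h) (E r * (dh - xi * h r)).
  move=> Dh; apply: (is_derive_eq (is_deriveM (DE r) Dh)).
  by rewrite /GRing.scale /=; ring.
have sumE r : \sum_i (E * f i) r ^+ 2 = E r ^+ 2 * \sum_i f i r ^+ 2.
  by rewrite mulr_sumr; apply: eq_bigr => i _; rewrite fctE exprMn.
have sqrtE r : Num.sqrt (\sum_i (E * f i) r ^+ 2) =
    E r * Num.sqrt (\sum_i f i r ^+ 2).
  by rewrite sumE sqrtrM ?sqr_ge0 // sqrtr_sqr gtr0_norm.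
suff : Num.sqrt (\sum_i (E * f i) s ^+ 2) <= (E * G) s.
  by rewrite sqrtE fctE ler_pM2l.
apply: (@norm_le_of_dissipative I (fun i => E * f i)
  (fun i r => E r * (df i r - xi * f i r)) (E * G) (fun r => E r * g r)) => //.
- move=> r; apply: (is_derive_eq (DEf _ _ _ (DG r))).
  by congr (_ * _); ring.
- by move=> r r0; rewrite mulr_ge0 ?g0 // ltW.
- move=> r r0; rewrite sqrtE.
  have -> : \sum_i (E * f i) r * (E r * (df i r - xi * f i r)) =
      E r ^+ 2 * (\sum_i f i r * df i r - xi * \sum_i f i r ^+ 2).
    rewrite mulr_sumr -sumrB mulr_sumr; apply: eq_bigr => i _.
    by rewrite fctE; ring.
  rewrite mulrACA -expr2 ler_pM2l ?exprn_gt0 // lerBlDl.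
  exact: diss.
- by rewrite sqrtE fctE ler_pM2l.
Qed.

End Comparison.

(** * Exponential generating functions of geometrically bounded sequences *)

Section GeometricBound.
Variable K : numDomainType.
Implicit Types (a b : nat -> K).

(** This growth makes the exponential generating function converge everywhere. Since bases are at
    least 1, bounds with bases [B] and [C] merge under [B * C]. *)
Definition geom_bounded a :=
  exists M B : K, [/\ 0 <= M, 1 <= B & forall k, `|a k| <= M * B ^+ k].

Lemma geom_bounded_eq a b : a =1 b -> geom_bounded a -> geom_bounded b.
Proof. by move=> /funext ->. Qed.

Lemma geom_bounded0 : geom_bounded (fun=> 0).
Proof. by exists 0, 1; split=> // k; rewrite normr0 mul0r. Qed.

Lemma geom_boundedZ c a : geom_bounded a -> geom_bounded (fun k => c * a k).
Proof.
case=> M [B [M0 B1 le_a]]; exists (`|c| * M), B; split=> // [|k].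
  exact: mulr_ge0.
by rewrite normrM -mulrA ler_wpM2l.
Qed.

Lemma geom_boundedD a b :
  geom_bounded a -> geom_bounded b -> geom_bounded (fun k => a k + b k).
Proof.
case=> M [B [M0 B1 le_a]] [N [C [N0 C1 le_b]]]; exists (M + N), (B * C).
have [B0 C0] := (le_trans ler01 B1, le_trans ler01 C1).
split=> [||k]; first exact: addr_ge0.
  by rewrite -[1]mulr1 ler_pM.
rewrite (le_trans (ler_normD _ _)) // mulrDl exprMn lerD //.
  rewrite (le_trans (le_a k)) // ler_wpM2l // ler_peMr ?exprn_ge0 //.
  exact: exprn_ege1.
rewrite (le_trans (le_b k)) // ler_wpM2l // ler_peMl ?exprn_ge0 //.
exact: exprn_ege1.
Qed.

Lemma geom_bounded_sum (I : Type) (r : seq I) (a : I -> nat -> K) :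
  (forall i, geom_bounded (a i)) ->
  geom_bounded (fun k => \sum_(i <- r) a i k).
Proof.
move=> bd_a; elim: r => [|i r IHr].
  by apply: geom_bounded_eq geom_bounded0 => k; rewrite big_nil.
apply: geom_bounded_eq (geom_boundedD (bd_a i) IHr) => k.
by rewrite big_cons.
Qed.

Lemma geom_boundedS a : geom_bounded a -> geom_bounded (fun k => a k.+1).
Proof.
case=> M [B [M0 B1 le_a]]; exists (M * B), B; split=> // [|k].
  by rewrite mulr_ge0 // (le_trans ler01).
by rewrite -mulrA -exprS.
Qed.

Lemma geom_bounded_addn p a :
  geom_bounded a -> geom_bounded (fun k => a (k + p)%N).
Proof.
move=> bd_a; elim: p => [|p IHp]; first by under eq_fun do rewrite addn0.
by under eq_fun do rewrite addnS -addSn; exact: geom_boundedS IHp.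
Qed.

Lemma geom_bounded_of_shift p a :
  geom_bounded (fun k => a (k + p)%N) -> geom_bounded a.
Proof.
elim: p a => [|p IHp] a bd_a.
  by apply: geom_bounded_eq bd_a => k; rewrite addn0.
have {}IHp : geom_bounded (fun k => a k.+1).
  by apply: IHp; apply: geom_bounded_eq bd_a => k; rewrite addnS.
case: IHp => M [B [M0 B1 le_a]].
have B0 := le_trans ler01 B1.
exists (`|a 0%N| + M), B; split=> // [|[|k]]; first exact: addr_ge0.
  by rewrite expr0 mulr1 lerDl.
rewrite (le_trans (le_a k)) // ler_pM ?exprn_ge0 // ?lerDr //.
by rewrite exprS ler_peMl ?exprn_ge0.
Qed.

Lemma geom_bounded_mulmxl m n p (A : 'M[K]_(m, n)) (X : nat -> 'M[K]_(n, p)) :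
  (forall i j, geom_bounded (fun k => X k i j)) ->
  forall i j, geom_bounded (fun k => (A *m X k) i j).
Proof.
move=> bd_X i j.
apply: geom_bounded_eq (geom_bounded_sum (index_enum 'I_n)
  (fun l => geom_boundedZ (A i l) (bd_X l j))) => k.
by rewrite mxE.
Qed.

Lemma geom_bounded_mulmxr m n p (A : 'M[K]_(n, p)) (X : nat -> 'M[K]_(m, n)) :
  (forall i j, geom_bounded (fun k => X k i j)) ->
  forall i j, geom_bounded (fun k => (X k *m A) i j).
Proof.
move=> bd_X i j.
apply: geom_bounded_eq (geom_bounded_sum (index_enum 'I_n)
  (fun l => geom_boundedZ (A l j) (bd_X i l))) => k.
by rewrite mxE; apply: eq_bigr => l _; rewrite mulrC.
Qed.

Lemma geom_bounded_expr_mx n (M : 'M[K]_n) i j :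
  geom_bounded (fun k => (M ^+ k) i j).
Proof.
pose B := 1 + \sum_i \sum_j `|M i j|.
have S0 : 0 <= \sum_i \sum_j `|M i j|.
  by apply: sumr_ge0 => ? _; apply: sumr_ge0.
have B1 : 1 <= B by rewrite lerDl.
exists 1, B; split=> // k; rewrite mul1r.
elim: k i => [|k IHk] i.
  by rewrite mxE; case: eqP; rewrite ?normr1 ?normr0 ?mulr1n ?mulr0n ?ler01.
rewrite exprS mxE (le_trans (ler_norm_sum _ _ _)) //.
have B0 : 0 <= B ^+ k by rewrite exprn_ge0 // (le_trans ler01).
apply: (@le_trans _ _ (\sum_l `|M i l| * B ^+ k)).
  by apply: ler_sum => l _; rewrite normrM ler_wpM2l.
rewrite -mulr_suml exprS ler_wpM2r // /B.
rewrite [X in _ <= 1 + X](bigD1 i) //= addrCA lerDl addr_ge0 //.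
by apply: sumr_ge0 => ? _; apply: sumr_ge0.
Qed.

Lemma geom_bounded_powdd (s : seq K) : geom_bounded (powdd s).
Proof.
elim: s => [|a s [M [B [M0 B1 le_s]]]]; first exact: geom_bounded0.
have B0 := le_trans ler01 B1.
have aB0 : 0 <= `|a| + B by exact: addr_ge0.
(* In the new base |a| + B, the part |a| pays for the multiplication by [a] and [B] for the term
   [powdd s k]; the added 1 covers the value at index 0. *)
exists (1 + M), (`|a| + B); split=> [||k]; first exact: addr_ge0.
  by rewrite (le_trans B1) // lerDr.
elim: k => [|k IHk].
  rewrite powdd_cons0 expr0 mulr1 normr_nat.
  by case: nilp; rewrite ?lerDl // addr_ge0.
rewrite powdd_consS (le_trans (ler_normD _ _)) // exprS.
rewrite mulrA [(1 + M) * _]mulrC -mulrA mulrDl lerD //.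
  by rewrite normrM ler_wpM2l.
rewrite (le_trans (le_s k)) // mulrCA ler_pM ?exprn_ge0 ?lerDr //.
apply: le_trans (ler_peMl _ B1); last exact: exprn_ge0.
by rewrite lerXn2r ?nnegrE ?lerDr.
Qed.

End GeometricBound.

Lemma geom_bounded_fact_ratio (K : numFieldType) p (a : nat -> K) :
  geom_bounded a ->
  geom_bounded (fun k => k`!%:R / (k + p)`!%:R * a k).
Proof.
case=> M [B [M0 B1 le_a]]; exists M, B; split=> // k.
rewrite normrM (le_trans _ (le_a k)) // ler_piMl //.
rewrite normf_div !normr_nat ler_pdivrMr ?ltr0n ?fact_gt0 // mul1r ler_nat.
elim: p => [|p IHp]; first by rewrite addn0.
by rewrite addnS factS (leq_trans IHp) // leq_pmull.
Qed.

Section Egf.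
Variable R : realType.
Implicit Types (a b : nat -> R) (x : R).

Definition egf a x : R := limn (pseries (fun k => a k / k`!%:R) x).

Lemma is_cvg_egf a x :
  geom_bounded a -> cvgn (pseries (fun k => a k / k`!%:R) x).
Proof.
case=> M [B [M0 B1 le_a]]; apply: normed_cvg.
apply: (@series_le_cvg _ _ (M *: exp_coeff (B * `|x|))) => [k|k|k|].
- exact: normr_ge0.
- by rewrite fctE mulr_ge0 // exp_coeff_ge0 // mulr_ge0 // (le_trans ler01).
- rewrite /= normrM normf_div normrX normr_nat.
  rewrite [X in _ <= X](_ : _ = M * B ^+ k * k`!%:R^-1 * `|x| ^+ k).
    by rewrite ler_wpM2r ?exprn_ge0 // ler_wpM2r ?invr_ge0.
  by rewrite fctE /exp_coeff /GRing.scale /= exprMn; ring.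
- apply: is_cvg_seriesZ; exact: is_cvg_series_exp_coeff.
Qed.

Lemma egfD a b x : geom_bounded a -> geom_bounded b ->
  egf (fun k => a k + b k) x = egf a x + egf b x.
Proof.
move=> bd_a bd_b; rewrite /egf -lim_seriesD; try exact: is_cvg_egf.
congr (lim (series _ @ \oo)); apply/funext => k.
by rewrite fctE /=; ring.
Qed.

Lemma egfZ c a x : geom_bounded a -> egf (fun k => c * a k) x = c * egf a x.
Proof.
move=> bd_a; rewrite /egf -[RHS]lim_seriesZ; last exact: is_cvg_egf.
congr (lim (series _ @ \oo)); apply/funext => k.
by rewrite fctE /GRing.scale /=; ring.
Qed.

Lemma egf0 x : egf (fun=> 0) x = 0.
Proof.
rewrite -[RHS](mul0r (egf (fun=> 0) x)) -egfZ; last exact: geom_bounded0.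
by congr (egf _ _); apply/funext => k; rewrite mul0r.
Qed.

Lemma egf_at0 a : egf a 0 = a 0%N.
Proof.
apply: (@lim_near_cst R) => //; near=> n.
rewrite /pseries /series /=; have -> : n = n.-1.+1.
  by rewrite prednK //; near: n; exact: nbhs_infty_gt.
rewrite big_nat_recl // big1 ?addr0 ?fact0 ?divr1 ?expr0 ?mulr1 // => k _.
by rewrite exprS mul0r mulr0.
Unshelve. all: by end_near. Qed.

Lemma is_derive_egf a x :
  geom_bounded a -> is_derive x 1 (egf a) (egf (fun k => a k.+1) x).
Proof.
move=> bd_a.
have diffs (c : nat -> R) : pseries_diffs (fun k => c k / k`!%:R) =
    (fun k => c k.+1 / k`!%:R).
  apply/funext => k; rewrite /pseries_diffs factS natrM invfM mulrCA.
  by rewrite mulVKf ?pnatr_eq0 //.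
have := @pseries_snd_diffs R (fun k => a k / k`!%:R) (`|x| + 1) x.
rewrite !diffs; apply.
- exact: is_cvg_egf.
- exact: is_cvg_egf (geom_boundedS bd_a).
- exact: is_cvg_egf (geom_boundedS (geom_boundedS bd_a)).
- by rewrite [`|_ + 1|]ger0_norm ?addr_ge0 // ltrDl.
Qed.

(** The factor k!/(k+p)! renormalizes the shifted coefficients; it is what distinguishes the
    coefficients of [phi p] from those of the exponential. *)
Lemma egf_shift p a x : geom_bounded a -> (forall k, (k < p)%N -> a k = 0) ->
  egf a x = x ^+ p * egf (fun k => k`!%:R / (k + p)`!%:R * a (k + p)%N) x.
Proof.
move=> bd_a a0.
have bd_ap := geom_bounded_addn p bd_a.
have cvg_b := @is_cvg_egf _ x (geom_bounded_fact_ratio p bd_ap).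
apply/cvg_lim => //; rewrite -(cvg_shiftn p).
rewrite [X in X @ \oo](_ : _ = (fun n => x ^+ p *
    pseries (fun k => k`!%:R / (k + p)`!%:R * a (k + p)%N / k`!%:R) x n)).
  exact: cvgMl_tmp cvg_b.
apply/funext => n; rewrite /pseries /series /= mulr_sumr addnC.
rewrite (big_cat_nat _ (n := p)) ?leq_addr //= big1_seq ?add0r => [|k].
  rewrite -{1}[p]add0n [(p + n)%N]addnC big_addn addnK; apply: eq_bigr => k _.
  rewrite exprD; field.
  by rewrite !pnatr_eq0 -!lt0n !fact_gt0.
by rewrite mem_index_iota => /andP[_ /andP[_ /a0 ->]]; rewrite !mul0r.
Qed.

End Egf.

(** * Generating functions with complex and matrix coefficients *)

Section ComplexEgf.
Variable R : realType.
Local Notation C := R[i].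

Lemma normc_Re_le (z x : C) : `|z| <= x -> `|complex.Re z| <= complex.Re x.
Proof.
case: z => u w; rewrite normc_def lecE /= => /andP[_]; apply: le_trans.
by rewrite -sqrtr_sqr ler_wsqrtr // lerDl sqr_ge0.
Qed.

Lemma normc_Im_le (z x : C) : `|z| <= x -> `|complex.Im z| <= complex.Re x.
Proof.
case: z => u w; rewrite normc_def lecE /= => /andP[_]; apply: le_trans.
by rewrite -sqrtr_sqr ler_wsqrtr // lerDr sqr_ge0.
Qed.

(** The order on [R[i]] forces [M] and [B] to be real, so a complex geometric bound is a real
    one. *)
Lemma Re_geometric (M B : C) k : 0 <= M -> 1 <= B ->
  [/\ 0 <= complex.Re M, 1 <= complex.Re B &
  complex.Re (M * B ^+ k) = complex.Re M * complex.Re B ^+ k].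
Proof.
move=> M0 B1; have B0 := le_trans ler01 B1.
have -> : M = (complex.Re M)%:C by rewrite RRe_real // ger0_real.
have eB : B = (complex.Re B)%:C by rewrite RRe_real // ger0_real.
split=> /=; first by rewrite -lecR -/(real_complex _ _) RRe_real // ger0_real.
  by rewrite -lecR -eB.
by rewrite eB -rmorphXn -rmorphM.
Qed.

Lemma geom_bounded_Re (a : nat -> C) :
  geom_bounded a -> geom_bounded (fun k => complex.Re (a k)).
Proof.
case=> M [B [M0 B1 le_a]]; exists (complex.Re M), (complex.Re B).
have [? ? _] := Re_geometric 0 M0 B1; split=> // k.
by have [_ _ <-] := Re_geometric k M0 B1; apply: normc_Re_le.
Qed.

Lemma geom_bounded_Im (a : nat -> C) :
  geom_bounded a -> geom_bounded (fun k => complex.Im (a k)).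
Proof.
case=> M [B [M0 B1 le_a]]; exists (complex.Re M), (complex.Re B).
have [? ? _] := Re_geometric 0 M0 B1; split=> // k.
by have [_ _ <-] := Re_geometric k M0 B1; apply: normc_Im_le.
Qed.

(** Split into parts so that only real functions of a real variable need to be differentiated. *)
Definition cegf (a : nat -> C) (x : R) : C :=
  egf (fun k => complex.Re (a k)) x +i* egf (fun k => complex.Im (a k)) x.

Lemma cegfD (a b : nat -> C) x : geom_bounded a -> geom_bounded b ->
  cegf (fun k => a k + b k) x = cegf a x + cegf b x.
Proof.
move=> bd_a bd_b; apply/eqP; rewrite eq_complex /=.
by rewrite -!egfD; try solve [exact: geom_bounded_Re | exact: geom_bounded_Im];
  apply/andP; split; apply/eqP; congr (egf _ _); apply/funext => k;
  case: (a k); case: (b k).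
Qed.

Lemma cegfZ (z : C) (a : nat -> C) x : geom_bounded a ->
  cegf (fun k => z * a k) x = z * cegf a x.
Proof.
move=> bd_a; have [bd_r bd_i] := (geom_bounded_Re bd_a, geom_bounded_Im bd_a).
apply/eqP; rewrite eq_complex; case: z => u w /=.
apply/andP; split; apply/eqP.
  rewrite -mulNr -!egfZ // -egfD; try exact: geom_boundedZ.
  by congr (egf _ _); apply/funext => k; case: (a k) => r i /=; rewrite mulNr.
rewrite -!egfZ // -egfD; try exact: geom_boundedZ.
by congr (egf _ _); apply/funext => k; case: (a k) => r i /=.
Qed.

Lemma cegf0 x : cegf (fun=> 0) x = 0.
Proof.
rewrite -[RHS](mul0r (cegf (fun=> 0) x)) -cegfZ; last exact: geom_bounded0.
by congr (cegf _ _); apply/funext => k; rewrite mul0r.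
Qed.

Lemma cegf_sum (I : Type) (r : seq I) (a : I -> nat -> C) x :
  (forall i, geom_bounded (a i)) ->
  cegf (fun k => \sum_(i <- r) a i k) x = \sum_(i <- r) cegf (a i) x.
Proof.
move=> bd_a; elim: r => [|i r IHr].
  rewrite big_nil -[RHS](cegf0 x); congr (cegf _ _).
  by apply/funext => k; rewrite big_nil.
rewrite big_cons -IHr -cegfD //; last exact: geom_bounded_sum.
by congr (cegf _ _); apply/funext => k; rewrite big_cons.
Qed.

Definition mxegf m n (X : nat -> 'M[C]_(m, n)) (x : R) : 'M[C]_(m, n) :=
  \matrix_(i, j) cegf (fun k => X k i j) x.

Lemma mxegf_mull m n p (A : 'M[C]_(m, n)) (X : nat -> 'M[C]_(n, p)) x :
  (forall i j, geom_bounded (fun k => X k i j)) ->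
  mxegf (fun k => A *m X k) x = A *m mxegf X x.
Proof.
move=> bd_X; apply/matrixP => i j; rewrite !mxE.
under eq_bigr => l _ do rewrite mxE -cegfZ //.
rewrite -cegf_sum => [|l]; last exact: geom_boundedZ.
by congr (cegf _ _); apply/funext => k; rewrite mxE.
Qed.

Lemma mxegf_mulr m n p (A : 'M[C]_(n, p)) (X : nat -> 'M[C]_(m, n)) x :
  (forall i j, geom_bounded (fun k => X k i j)) ->
  mxegf (fun k => X k *m A) x = mxegf X x *m A.
Proof.
move=> bd_X; apply/matrixP => i j; rewrite !mxE.
under eq_bigr => l _ do rewrite mxE mulrC -cegfZ //.
rewrite -cegf_sum => [|l]; last exact: geom_boundedZ.
congr (cegf _ _); apply/funext => k; rewrite mxE.
by apply: eq_bigr => l _; rewrite mulrC.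
Qed.

Lemma mxegfD m n (X Y : nat -> 'M[C]_(m, n)) x :
  (forall i j, geom_bounded (fun k => X k i j)) ->
  (forall i j, geom_bounded (fun k => Y k i j)) ->
  mxegf (fun k => X k + Y k) x = mxegf X x + mxegf Y x.
Proof.
move=> bd_X bd_Y; apply/matrixP => i j; rewrite !mxE -cegfD //.
by congr (cegf _ _); apply/funext => k; rewrite mxE.
Qed.

End ComplexEgf.

(** * The Euclidean norm and the logarithmic norm *)

Section Norm2.
Variables (R : realType).
Local Notation C := R[i].

(** The Euclidean inner product of C^n viewed as R^(2n), in the coordinates listed by [coords]. *)
Definition redot n (u v : 'cV[C]_n) : R :=
  \sum_i (complex.Re (u i 0) * complex.Re (v i 0)
        + complex.Im (u i 0) * complex.Im (v i 0)).

Lemma redotE n (u v : 'cV[C]_n) : redot u v = complex.Re ((u^t* *m v) 0 0).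
Proof.
rewrite mxE raddf_sum /=; apply: eq_bigr => i _; rewrite !mxE.
by case: (u i 0) => a b; case: (v i 0) => c d /=; ring.
Qed.

Lemma redotDr n (u v w : 'cV[C]_n) : redot u (v + w) = redot u v + redot u w.
Proof.
rewrite /redot -big_split /=; apply: eq_bigr => i _.
by rewrite mxE !raddfD /=; ring.
Qed.

Lemma norm2_ge0 n (u : 'cV[C]_n) : 0 <= norm2 u.
Proof. exact: sqrtr_ge0. Qed.

Lemma norm2_sqr n (u : 'cV[C]_n) : norm2 u ^+ 2 = redot u u.
Proof.
rewrite sqr_sqrtr; last by apply: sumr_ge0 => i _; rewrite addr_ge0 ?sqr_ge0.
by apply: eq_bigr => i _; rewrite !expr2.
Qed.

Definition coords n (u : 'cV[C]_n) (i : 'I_n + 'I_n) : R :=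
  match i with inl i => complex.Re (u i 0) | inr i => complex.Im (u i 0) end.

Lemma redot_coords n (u v : 'cV[C]_n) :
  redot u v = \sum_i coords u i * coords v i.
Proof. by rewrite big_sumType /= -big_split. Qed.

Lemma norm2_coords n (u : 'cV[C]_n) :
  norm2 u = Num.sqrt (\sum_i coords u i ^+ 2).
Proof. by rewrite big_sumType /= -big_split. Qed.

Lemma redot_le_norm2 n (u v : 'cV[C]_n) : redot u v <= norm2 u * norm2 v.
Proof. by rewrite redot_coords !norm2_coords; exact: le_sum_sqrt_cauchy. Qed.

Lemma norm2Z n (z : C) (u : 'cV[C]_n) :
  norm2 (z *: u) = complex.Re `|z| * norm2 u.
Proof.
rewrite normc_def /= /norm2 -sqrtrM ?addr_ge0 ?sqr_ge0 // mulr_sumr.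
congr Num.sqrt; apply: eq_bigr => i _; rewrite mxE.
by case: z => a b; case: (u i 0) => c d /=; ring.
Qed.

Lemma norm2_const1 (z : C) : norm2 (const_mx z : 'cV_1) = complex.Re `|z|.
Proof. by rewrite normc_def /= /norm2 big_ord1 mxE. Qed.

(** The recurrences say that [mxegf c] solves y' = A y + b and that [egf a] solves z' = xi z + g, so
    [norm_le_of_log_growth] compares them. It serves both for divided differences, in dimension one,
    and for the Krylov error. *)
Lemma mxegf_norm_le n (A : 'M[C]_n) (xi : R) (c b : nat -> 'cV[C]_n)
    (a g : nat -> R) :
  (forall u, redot u (A *m u) <= xi * norm2 u ^+ 2) ->
  (forall i j, geom_bounded (fun k => c k i j)) ->
  (forall i j, geom_bounded (fun k => b k i j)) ->
  geom_bounded a -> geom_bounded g ->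
  (forall k, c k.+1 = A *m c k + b k) ->
  (forall k, a k.+1 = xi * a k + g k) ->
  norm2 (c 0%N) <= a 0%N ->
  (forall s : R, 0 <= s -> norm2 (mxegf b s) <= egf g s) ->
  forall s : R, 0 <= s -> norm2 (mxegf c s) <= egf a s.
Proof.
move=> dissA bd_c bd_b bd_a bd_g cS aS init le_b s s0.
have dcE (r : R) : mxegf (fun k => c k.+1) r = A *m mxegf c r + mxegf b r.
  rewrite -mxegf_mull // -mxegfD //; last exact: geom_bounded_mulmxl.
  by congr (mxegf _ _); apply/funext.
have daE (r : R) : egf (fun k => a k.+1) r = xi * egf a r + egf g r.
  rewrite -egfZ // -egfD //; last exact: geom_boundedZ.
  by congr (egf _ _); apply/funext.
rewrite norm2_coords.
apply: (@norm_le_of_log_growth R xi _ (fun i r => coords (mxegf c r) i)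
  (fun i r => coords (mxegf (fun k => c k.+1) r) i) (egf a) (egf g)) => //.
- case=> i r.
    rewrite /coords mxE /= (_ : (fun _ => _) =
      egf (fun k => complex.Re (c k i 0))); last first.
      by apply/funext => x; rewrite mxE.
    exact/is_derive_egf/geom_bounded_Re.
  rewrite /coords mxE /= (_ : (fun _ => _) =
    egf (fun k => complex.Im (c k i 0))); last first.
    by apply/funext => x; rewrite mxE.
  exact/is_derive_egf/geom_bounded_Im.
- by move=> r; rewrite -daE; exact: is_derive_egf.
- by move=> r r0; apply: le_trans (le_b r r0); exact: norm2_ge0.
- move=> r r0; rewrite -redot_coords dcE redotDr -norm2_coords.
  rewrite (_ : \sum_i _ = norm2 (mxegf c r) ^+ 2); last first.
    by rewrite norm2_sqr redot_coords; apply: eq_bigr => i _; rewrite expr2.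
  apply: lerD (dissA _) (le_trans (redot_le_norm2 _ _) _).
  by rewrite ler_wpM2l ?norm2_ge0 ?le_b.
- rewrite -norm2_coords egf_at0 (_ : mxegf c 0 = c 0%N) //.
  by apply/matrixP => i j; rewrite !mxE /cegf !egf_at0; case: (c _ _ _).
Qed.

(** Prepending a node [z] means solving y' = z y + g with g the function of the shorter list;
    [mxegf_norm_le] applies with the 1 x 1 matrix [z] and [xi] its real part. *)
Lemma norm_cegf_powdd_le (l : seq C) (s : R) : 0 <= s ->
  complex.Re `|cegf (powdd l) s| <=
  egf (powdd [seq complex.Re z | z <- l]) s.
Proof.
elim: l s => [|z l IHl] s s0.
  have -> : cegf (powdd [::]) s = 0 := cegf0 s.
  by rewrite normr0 [egf _ _]egf0.
pose c (a : nat -> C) k : 'cV[C]_1 := const_mx (a k).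
have bd_c a : geom_bounded a -> forall i j, geom_bounded (fun k => c a k i j).
  by move=> bd_a i j; apply: geom_bounded_eq bd_a => k; rewrite mxE.
have cE a r : norm2 (mxegf (c a) r) = complex.Re `|cegf a r|.
  rewrite -norm2_const1; congr norm2; apply/matrixP => i j; rewrite !mxE.
  by congr (cegf _ _); apply/funext => k; rewrite mxE.
rewrite -cE; apply: (@mxegf_norm_le _ z%:M (complex.Re z) _ (c (powdd l))
  _ (powdd [seq complex.Re x | x <- l])) => //.
- move=> u; rewrite norm2_sqr mul_scalar_mx mulr_sumr /redot.
  apply: ler_sum => i _; rewrite mxE; case: z (u i 0) => a b [d e] /=.
  by rewrite le_eqVlt; apply/orP; left; apply/eqP; ring.
- exact/bd_c/geom_bounded_powdd.
- exact/bd_c/geom_bounded_powdd.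
- exact: geom_bounded_powdd.
- exact: geom_bounded_powdd.
- move=> k; apply/matrixP => i j; rewrite mul_scalar_mx !mxE.
  exact: powdd_consS.
- rewrite norm2_const1 !powdd_0 [size (map _ _)]size_map normr_nat.
  by case: (size _ == 1%N).
- by move=> r r0; rewrite cE IHl.
Qed.

End Norm2.

Section LogNorm.
Variables (R : realType) (n : nat).
Local Notation C := R[i].

Lemma eigenvalue_le_sup (S : 'M[C]_n) (x : R) :
  eigenvalue S x%:C -> x <= sup [set y : R | eigenvalue S y%:C].
Proof.
move=> eig_x; apply: ub_le_sup => //.
have [r def_S] := closed_field_poly_normal (char_poly S).
(* A crude upper bound of the real spectrum; for an unbounded set [sup] would only be a default
   value. *)
exists (\sum_(z <- r) `|complex.Re z|) => y /=.
rewrite eigenvalue_root_char def_S (monicP (char_poly_monic S)) scale1r.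
rewrite root_prod_XsubC => r_y; rewrite (big_rem _ r_y) /=.
by rewrite (le_trans (ler_norm y)) // lerDl sumr_ge0.
Qed.

(** In a unitary eigenbasis the left side is the sum of the squared moduli of the coordinates
    weighted by the eigenvalues, all real and at most [L]. *)
Lemma hermitian_redot_le (S : 'M[C]_n) (L : R) (u : 'cV[C]_n) :
  S ^t* = S -> (forall x : R, eigenvalue S x%:C -> x <= L) ->
  redot u (S *m u) <= L * norm2 u ^+ 2.
Proof.
move=> hermS le_L.
have hermS' : S \is hermsymmx.
  by apply/is_hermitianmxP; rewrite expr0 scale1r hermS.
have /orthomx_spectralP def_S := hermitian_normalmx hermS'.
have unitP := spectral_unitarymx S.
set P := spectralmx S in def_S unitP; set D := spectral_diag S in def_S.
have P_unit := unitarymx_unit unitP.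
have D_le i : complex.Im (D 0 i) = 0 /\ complex.Re (D 0 i) <= L.
  have Dreal : D 0 i \is Num.real.
    by have /mxOverP/(_ 0 i) := hermitian_spectral_diag_real hermS'.
  have ReD := RRe_real Dreal; split; first by rewrite -ReD.
  (* [eigenvalue] refers to row vectors, and the rows of [P] are left eigenvectors of [S], nonzero
     because [P] is invertible. *)
  apply: le_L; rewrite ReD; apply/eigenvalueP; exists (row i P).
    rewrite -row_mul def_S !mulmxA mulmxV // mul1mx.
    by apply/rowP => j; rewrite mul_diag_mx !mxE.
  apply/eqP => Pi0.
  have : row i (P *m invmx P) = 0 by rewrite row_mul Pi0 mul0mx.
  rewrite mulmxV // => /rowP/(_ i); rewrite !mxE eqxx => /eqP.
  by rewrite oner_eq0.
have dotP v w : redot (P *m v) (P *m w) = redot v w.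
  rewrite !redotE trmx_mul map_mxM mulmxA -[_ *m P]mulmxA.
  by rewrite -(invmx_unitary unitP) (mulVmx P_unit) mulmx1.
rewrite norm2_sqr -dotP {1}def_S !mulmxA mulmxV // mul1mx -[in X in _ <= X]dotP.
rewrite -mulmxA; move: (P *m u) => {}u.
rewrite mulr_sumr; apply: ler_sum => i _.
have [ImD ReD] := D_le i.
rewrite mul_diag_mx mxE.
move: ImD ReD; case: (D 0 i) (u i 0) => a b [c d] /= -> le_aL.
have := ler_wpM2r (sqr_ge0 c) le_aL; have := ler_wpM2r (sqr_ge0 d) le_aL.
lra.
Qed.

(** The quadratic forms of [A] and of its adjoint are conjugate, so passing to the Hermitian part of
    [A] keeps the real part. *)
Lemma redot_mul_le_log_norm2 (A : 'M[C]_n) (u : 'cV[C]_n) :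
  redot u (A *m u) <= log_norm2 A * norm2 u ^+ 2.
Proof.
pose S : 'M[C]_n := 2%:R^-1 *: (A + A ^t*).
have hermS : S ^t* = S.
  apply/matrixP => i j; rewrite !mxE rmorphM rmorphD fmorphV rmorph_nat /=.
  by rewrite conjCK addrC.
have -> : redot u (A *m u) = redot u (S *m u).
  rewrite !redotE -scalemxAl -scalemxAr mulmxDl mulmxDr [in RHS]mxE [in RHS]mxE.
  have -> : (u ^t* *m (A ^t* *m u)) 0 0 = ((u ^t* *m (A *m u)) 0 0)^*.
    transitivity ((u ^t* *m (A *m u)) ^t* 0 0); last by rewrite !mxE.
    by rewrite !trmx_mul !map_mxM map_trmx trmxK -map_mx_comp
      (map_mx_id (@conjCK _)) mulmxA.
  move: (_ 0 0) => z; rewrite mulrC addcJ mulrAC divff ?pnatr_eq0 ?mul1r //.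
by apply: hermitian_redot_le => // x; exact: eigenvalue_le_sup.
Qed.

End LogNorm.

(** * The phi functions of a matrix *)

Lemma exprmxZ (K : comNzRingType) n (c : K) (M : 'M[K]_n) k :
  (c *: M) ^+ k = c ^+ k *: M ^+ k.
Proof.
elim: k => [|k IHk]; first by rewrite !expr0 scale1r.
rewrite !exprS IHk -scalerA; move: (M ^+ k) => N.
by rewrite [LHS](esym (scalemxAl _ _ _)) -scalemxAr.
Qed.

Section PhiMx.
Variable R : realType.
Local Notation C := R[i].

Lemma matrix_hausdorff (K : numFieldType) (m n : nat) :
  hausdorff_space 'M[K]_(m, n).
Proof.
move=> M N clMN; apply/matrixP => i j; apply: norm_hausdorff => A B nA nB.
have [X [AX BX]] := clMN _ _ (@coord_continuous K m n i j M A nA)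
  (@coord_continuous K m n i j N B nB).
by exists (X i j).
Qed.

Lemma lim_mx_entries (K : numFieldType) (m n : nat) (u : nat -> 'M[K]_(m, n))
    (L : 'M[K]_(m, n)) :
  (forall e, 0 < e ->
    \forall N \near \oo, forall i j, `|L i j - u N i j| < e) ->
  lim (u @ \oo) = L.
Proof.
move=> uL; apply/cvg_lim; first exact: matrix_hausdorff.
apply/cvg_ballP => e e0; apply: filterS (uL e e0) => N near_N.
by split=> // i j; rewrite -ball_normE.
Qed.

Lemma near_series_mxegf m n (X : nat -> 'M[C]_(m, n)) (t : R) :
  (forall i j, geom_bounded (fun k => X k i j)) ->
  forall e : C, 0 < e -> \forall N \near \oo, forall i j,
  `|mxegf X t i j - series (fun k => (t ^+ k / k`!%:R)%:C *: X k) N i j| < e.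
Proof.
move=> bd_X e e0.
have [re0 eE] : 0 < complex.Re e /\ e = (complex.Re e)%:C.
  by move: e0; rewrite ltcE; case: e => a b /= /andP[/eqP -> ?].
(* Half of the tolerance goes to the real parts, half to the imaginary parts. *)
have e20 : 0 < complex.Re e / 2 by rewrite divr_gt0.
have : \forall N \near \oo, forall (i : 'I_m) (j : 'I_n),
    `|egf (fun k => complex.Re (X k i j)) t -
      pseries (fun k => complex.Re (X k i j) / k`!%:R) t N| < complex.Re e / 2
 /\ `|egf (fun k => complex.Im (X k i j)) t -
      pseries (fun k => complex.Im (X k i j) / k`!%:R) t N| < complex.Re e / 2.
  apply: filter_forall => i; apply: filter_forall => j.
  near=> N; split; near: N.
    move/cvgrPdist_lt: (@is_cvg_egf _ _ t (geom_bounded_Re (bd_X i j))).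
    exact.
  by move/cvgrPdist_lt: (@is_cvg_egf _ _ t (geom_bounded_Im (bd_X i j))); apply.
apply: filterS => N near_N i j.
have [Re_lt Im_lt] := near_N i j.
rewrite mxE summxE eE.
under eq_bigr do rewrite mxE.
rewrite (_ : \sum_(_ <= k < _) _ =
    pseries (fun k => complex.Re (X k i j) / k`!%:R) t N +i*
    pseries (fun k => complex.Im (X k i j) / k`!%:R) t N); last first.
  apply/eqP; rewrite eq_complex !raddf_sum /=; apply/andP; split; apply/eqP.
    by apply: eq_bigr => k _ /=; case: (X k i j) => a b /=; ring.
  by apply: eq_bigr => k _ /=; case: (X k i j) => a b /=; ring.
rewrite /cegf; move: Re_lt Im_lt; set a := egf _ _; set b := egf _ _.
move: (pseries _ _ _) (pseries _ _ _) => d c ltac ltbd.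
rewrite (_ : _ - _ = (a - c)%:C + (b - d)%:C * 'i); last first.
  by apply/eqP; rewrite eq_complex /=; apply/andP; split; apply/eqP; ring.
apply: le_lt_trans (ler_normD _ _) _; rewrite normrM !normc_def /= expr0n /=.
rewrite !addr0 add0r expr1n sqrtr1 mulr1 -rmorphD ltcR !sqrtr_sqr.
lra.
Unshelve. all: by end_near. Qed.

(** Here [t] sits in the coefficients and [x] is the variable, since divided differences
    differentiate in [x]; [phi_mxE] expands in [t] instead. *)
Lemma phiE p (x t : R) :
  phi p (t * x) = egf (fun k => k`!%:R / (k + p)`!%:R * t ^+ k) x.
Proof.
congr (lim (series _ @ \oo)); apply/funext => k.
rewrite /= exprMn; field.
by rewrite !pnatr_eq0 -!lt0n !fact_gt0.
Qed.

Lemma geom_bounded_fact_ratio_mx m n p (X : nat -> 'M[C]_(m, n)) i j :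
  geom_bounded (fun k => X k i j) ->
  geom_bounded (fun k => ((k`!%:R / (k + p)`!%:R)%:C *: X k) i j).
Proof.
move=> bd_X; apply: geom_bounded_eq (geom_bounded_fact_ratio p bd_X) => k.
by rewrite mxE rmorphM fmorphV !rmorph_nat.
Qed.

Lemma phi_mxE n p (M : 'M[C]_n) (t : R) :
  phi_mx p (t%:C *: M) =
  mxegf (fun k => (k`!%:R / (k + p)`!%:R)%:C *: M ^+ k) t.
Proof.
apply: (@lim_mx_entries R[i] n n) => e e0.
have bd i j := geom_bounded_fact_ratio_mx p (geom_bounded_expr_mx M i j).
apply: filterS (near_series_mxegf t bd e0) => N near_N i j.
rewrite (le_lt_trans _ (near_N i j)) // le_eqVlt; apply/orP; left; apply/eqP.
congr `|_ - fun_of_matrix (series _ _) _ _|; apply/funext => k.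
rewrite scalerA -rmorphM exprmxZ scalerA -rmorphXn.
rewrite -(rmorph_nat (real_complex R)) -fmorphV -rmorphM; congr (_%:C *: _).
by field; rewrite !pnatr_eq0 -!lt0n !fact_gt0.
Qed.

(** On generating functions this is [p]-fold integration from 0. *)
Definition delay m n p (X : nat -> 'M[C]_(m, n)) k :=
  if (k < p)%N then 0 else X (k - p)%N.

Lemma geom_bounded_delay m n p (X : nat -> 'M[C]_(m, n)) i j :
  geom_bounded (fun k => X k i j) -> geom_bounded (fun k => delay p X k i j).
Proof.
move=> bd_X; apply: (@geom_bounded_of_shift _ p).
apply: geom_bounded_eq bd_X => k.
by rewrite /delay ltnNge leq_addl /= addnK.
Qed.

Lemma mxegf_delay m n p (X : nat -> 'M[C]_(m, n)) (t : R) :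
  (forall i j, geom_bounded (fun k => X k i j)) ->
  mxegf (delay p X) t =
  (t ^+ p)%:C *: mxegf (fun k => (k`!%:R / (k + p)`!%:R)%:C *: X k) t.
Proof.
move=> bd_X; apply/matrixP => i j; rewrite !mxE /cegf.
have bd_dX := geom_bounded_delay p (bd_X i j).
have delay0 k : (k < p)%N -> delay p X k i j = 0.
  by rewrite /delay => ->; rewrite mxE.
have delayE k : delay p X (k + p) i j = X k i j.
  by rewrite /delay ltnNge leq_addl /= addnK.
rewrite (@egf_shift _ p (fun k => complex.Re (delay p X k i j))).
rewrite (@egf_shift _ p (fun k => complex.Im (delay p X k i j))).
- apply/eqP; rewrite eq_complex /= !mul0r subr0 addr0.
  apply/andP; split; apply/eqP; congr (_ * egf _ _); apply/funext => k.
    by rewrite delayE mxE; case: (X k i j) => a b /=; ring.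
  by rewrite delayE mxE; case: (X k i j) => a b /=; ring.
- exact: geom_bounded_Im.
- by move=> k /delay0 ->.
- exact: geom_bounded_Re.
- by move=> k /delay0 ->.
Qed.

Lemma mxegf_delay_phi_mx q n r p (U : 'M[C]_(q, n)) (M : 'M[C]_n)
    (Y : 'M[C]_(n, r)) (t : R) :
  mxegf (delay p (fun k => U *m M ^+ k *m Y)) t =
  (t ^+ p)%:C *: (U *m phi_mx p (t%:C *: M) *m Y).
Proof.
have bd_M := geom_bounded_expr_mx M.
rewrite phi_mxE mxegf_delay; last first.
  by move=> i j; apply: geom_bounded_mulmxr; apply: geom_bounded_mulmxl.
have bd_phi i j := geom_bounded_fact_ratio_mx p (bd_M i j).
rewrite -mxegf_mull // -mxegf_mulr; last first.
  by move=> i j; apply: geom_bounded_mulmxl.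
have -> : (fun k => (k`!%:R / (k + p)`!%:R)%:C *: (U *m M ^+ k *m Y)) =
    (fun k => U *m ((k`!%:R / (k + p)`!%:R)%:C *: M ^+ k) *m Y) => //.
by apply/funext => k; rewrite -scalemxAr -scalemxAl.
Qed.

End PhiMx.

(** * Divided differences of the phi functions *)

Section DividedDifference.
Variable R : realType.
Implicit Types (a x t : R) (s : seq R).

Lemma geom_bounded_X (K : numDomainType) (z : K) :
  geom_bounded (fun k => z ^+ k).
Proof.
exists 1, (1 + `|z|); split=> // [|k]; first by rewrite lerDl.
by rewrite mul1r normrX lerXn2r ?nnegrE ?addr_ge0 ?lerDr.
Qed.

Lemma derive1n_egf (a : nat -> R) n : geom_bounded a ->
  derive1n n (egf a) = egf (fun k => a (k + n)%N).
Proof.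
elim: n a => [|n IHn] a bd_a.
  by congr egf; apply/funext => k; rewrite addn0.
rewrite derive1Sn (_ : derive1 (egf a) = egf (fun k => a k.+1)).
  rewrite IHn; last exact: geom_boundedS.
  by congr egf; apply/funext => k; rewrite addnS.
apply/funext => x; rewrite derive1E.
exact: (@derive_val _ _ _ _ _ _ _ (is_derive_egf x bd_a)).
Qed.

(* The divided difference of [x |-> phi p (t * x)] over [s], taken termwise. *)
Definition phidd p s t := egf (fun k => k`!%:R / (k + p)`!%:R * powdd s k) t.

Lemma egf_powdd_nseq0 p a s t :
  egf (powdd (nseq p 0 ++ a :: s)) t = t ^+ p * phidd p (a :: s) t.
Proof.
rewrite (@egf_shift _ p); first 1 last.
- exact: geom_bounded_powdd.
- exact: powdd_nseq0_lt.
by congr (_ * egf _ _); apply/funext => k; rewrite powdd_nseq0.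
Qed.

Lemma phidd_ends p a s b t :
  (b - a) * phidd p (a :: rcons s b) t =
  phidd p (rcons s b) t - phidd p (a :: s) t.
Proof.
have bd l := geom_bounded_fact_ratio p (geom_bounded_powdd l).
rewrite /phidd -egfZ; last exact: bd.
rewrite -[- egf _ _]mulN1r -egfZ; last exact: bd.
rewrite -egfD; [|exact: bd|by apply: geom_boundedZ; exact: bd].
congr (egf _ _); apply/funext => k.
by rewrite mulrCA powdd_ends; ring.
Qed.

Lemma phidd_nseq p k a t :
  phidd p (nseq k.+1 a) t = derive1n k (fun x => phi p (t * x)) a / k`!%:R.
Proof.
have -> : (fun x => phi p (t * x)) =
    egf (fun j => j`!%:R / (j + p)`!%:R * t ^+ j).
  by apply/funext => x; exact: phiE.
have bd_t := geom_bounded_fact_ratio p (geom_bounded_X t).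
have bd_a := geom_bounded_fact_ratio p (geom_bounded_powdd (nseq k.+1 a)).
(* The left side is a series in [t], the right side one in [a]; factoring out the [k] vanishing
   leading terms in [t] makes them agree termwise. *)
rewrite derive1n_egf // /phidd (@egf_shift _ k) //; last first.
  by move=> j lt_jk; rewrite powdd_lt ?mulr0 // size_nseq ltnS.
rewrite [RHS]mulrC -!egfZ.
- congr (lim (series _ @ \oo)); apply/funext => j.
  rewrite /mk_sequence powdd_nseq -(bin_fact (leq_addl j k)) addnK.
  rewrite -mulr_natl !natrM exprD.
  field.
  by rewrite !pnatr_eq0 -!lt0n !fact_gt0 bin_gt0 leq_addl.
- exact: geom_bounded_addn bd_t.
- exact: geom_bounded_fact_ratio (geom_bounded_addn k bd_a).
Qed.

(** [phidd] satisfies both clauses of the recursion, by [phidd_nseq] and [phidd_ends]. Monotonicity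
    is limited to indices below [N] because [nth] returns a default past the end of a list. *)
Lemma divdiff_rec_phi p t (x : nat -> R) N k i :
  (forall j j', (j <= j' < N)%N -> x j <= x j') -> (i + k < N)%N ->
  divdiff_rec (fun y => phi p (t * y)) x k i =
  phidd p [seq x j | j <- iota i k.+1] t.
Proof.
move=> x_mono; elim: k i => [|k IHk] i lt_ikN.
  by rewrite /divdiff_rec addn0 eqxx -phidd_nseq.
rewrite /divdiff_rec -/divdiff_rec; have [eq_x|neq_x] := eqVneq.
  rewrite -phidd_nseq; congr phidd.
  apply: (@eq_from_nth _ 0); first by rewrite size_nseq size_map size_iota.
  move=> j; rewrite size_nseq => lt_jk.
  rewrite (nth_map 0%N) ?size_iota // nth_nseq nth_iota //; rewrite ifT //.
  have lt_ijN : (i + j < N)%N.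
    by rewrite (leq_ltn_trans _ lt_ikN) // leq_add2l -ltnS.
  (* Equal end nodes squeeze every node between them. *)
  apply: le_anti; rewrite x_mono ?leq_addr //= eq_x x_mono //.
  by rewrite leq_add2l -ltnS lt_jk.
rewrite !IHk; last 2 first.
- by rewrite (leq_trans _ lt_ikN) // ltnS leq_add2l.
- by rewrite addSnnS.
have -> : iota i k.+2 = i :: rcons (iota i.+1 k) (i + k.+1)%N.
  by rewrite -addSnnS -cats1 -[[:: _]]/(iota (i.+1 + k) 1) -iotaD addn1.
have -> : iota i.+1 k.+1 = rcons (iota i.+1 k) (i + k.+1)%N.
  by rewrite -addSnnS -cats1 -[[:: _]]/(iota (i.+1 + k) 1) -iotaD addn1.
rewrite /= !map_rcons -phidd_ends mulrAC mulfV ?mul1r // subr_eq0 eq_sym.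
exact: neq_x.
Qed.

Lemma divdiff_phi p t s : s != [::] ->
  divdiff (fun y => phi p (t * y)) s = phidd p (sort <=%R s) t.
Proof.
move=> s_neq0; rewrite /divdiff -(size_sort <=%R s).
have : sort <=%R s != [::] by rewrite -size_eq0 size_sort size_eq0.
have := sort_sorted le_total s; move: (sort _ s) => {s_neq0}s sorted_s s_neq0.
have s_gt0 : (0 < size s)%N by case: s s_neq0 {sorted_s}.
rewrite (@divdiff_rec_phi _ _ _ (size s)) ?add0n ?prednK //.
  by rewrite map_nth_iota0 ?take_size.
move=> j j' /andP[le_jj' lt_j's].
by rewrite (sorted_leq_nth le_trans) // inE (leq_ltn_trans le_jj').
Qed.

End DividedDifference.

(** * The error equation of the Krylov propagator and its scalar majorant *)

Theorem theorem4 (R : realType) (p : nat) (t : R) (n m : nat)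
    (A : 'M[R[i]]_n) (v : 'cV[R[i]]_n)
    (V : 'M[R[i]]_(n, m.+1)) (H : 'M[R[i]]_(m.+1))
    (h : R) (w : 'cV[R[i]]_n) (lambda : (m.+1).-tuple R[i])
    (t_gt0 : 0 < t) (v_neq0 : v != 0)
    (arnoldiA : arnoldi_decomposition A v V H h w)
    (log_normA : log_norm2 A <= 0)
    (eigH : char_poly H = \prod_(l <- lambda) ('X - l%:P)) :
  norm2 ((norm2 v)%:C *: (V *m phi_mx p (t%:C *: H) *m delta_mx 0 0)
         - phi_mx p (t%:C *: A) *m v)
  <= norm2 v * h * subdiag_prod H * t
     * divdiff (fun x : R => phi p.+1 (t * x))
         [seq complex.Re l | l <- lambda].
Proof.
case: arnoldiA => _ _ start _ hessH subdiagH h_gt0 norm_w _ AV.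
set beta := norm2 v in start *.
have beta_ge0 : 0 <= beta by exact: norm2_ge0.
set gam := subdiag_prod H.
have [gamE gam_ge0] :
    \prod_(j < m) H (lift ord0 j) (widen_ord (leqnSn m) j) = gam%:C /\ 0 <= gam.
  have prod_gt0 : 0 < \prod_(j < m) H (lift ord0 j) (widen_ord (leqnSn m) j).
    by apply: prodr_gt0 => j _; rewrite subdiagH // lift0.
  split; first by rewrite RRe_real // gtr0_real.
  by move: prod_gt0; rewrite ltcE => /andP[_ /ltW].
(* Sorting by real part makes the list of real parts the one that [divdiff] uses; the characteristic
   polynomial is unaffected by the order. *)
pose lam := sort (relpre (@complex.Re R) <=%R) lambda.
have lamE : [seq complex.Re l | l <- lam] =
    sort <=%R [seq complex.Re l | l <- lambda].
  by rewrite sort_map.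
have [l0 [lam0 lam_cons]] : exists l0 lam0, lam = l0 :: lam0.
  have : size lam = m.+1 by rewrite size_sort size_tuple.
  by case: (lam) => // l0 lam0 _; exists l0, lam0.
have cornerH k : (H ^+ k) ord_max 0 = gam%:C * powdd lam k.
  rewrite -gamE; apply: hessenberg_expr_corner => //.
  by rewrite eigH; apply: perm_big; rewrite perm_sym perm_sort.
(* The Taylor coefficients of the error for the exponential; delaying them by [p] gives [t ^+ p]
   times the error for [phi p]. *)
pose X k := beta%:C *: (V *m H ^+ k *m delta_mx 0 0) - A ^+ k *m v.
have XE k : X k = (beta%:C *: V) *m H ^+ k *m delta_mx 0 0 + A ^+ k *m (- v).
  by rewrite /X mulmxN -!scalemxAl.
have bd_X i j : geom_bounded (fun k => X k i j).
  rewrite (_ : (fun _ => _) = fun k =>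
    ((beta%:C *: V) *m H ^+ k *m delta_mx 0 0) i j + (A ^+ k *m (- v)) i j).
    apply: geom_boundedD; last exact/geom_bounded_mulmxr/geom_bounded_expr_mx.
    by apply/geom_bounded_mulmxr/geom_bounded_mulmxl/geom_bounded_expr_mx.
  by apply/funext => k; rewrite XE mxE.
pose K := beta * h * gam.
have K_ge0 : 0 <= K by rewrite !mulr_ge0 // ltW.
have errE : mxegf (delay p X) t = (t ^+ p)%:C *:
    (beta%:C *: (V *m phi_mx p (t%:C *: H) *m delta_mx 0 0)
     - phi_mx p (t%:C *: A) *m v).
  have delayE : delay p X = fun k =>
      delay p (fun k => (beta%:C *: V) *m H ^+ k *m delta_mx 0 0) k
      + delay p (fun k => 1%:M *m A ^+ k *m (- v)) k.
    apply/funext => k; rewrite /delay; case: ifP => _; first by rewrite addr0.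
    by rewrite XE mul1mx.
  rewrite delayE mxegfD.
  - rewrite !mxegf_delay_phi_mx mul1mx mulmxN -scalerDr.
    by rewrite -!scalemxAl.
  - move=> i j; apply/geom_bounded_delay/geom_bounded_mulmxr.
    exact/geom_bounded_mulmxl/geom_bounded_expr_mx.
  - move=> i j; apply/geom_bounded_delay/geom_bounded_mulmxr.
    exact/geom_bounded_mulmxl/geom_bounded_expr_mx.
have X0 : X 0%N = 0.
  by rewrite /X !expr0 mulmx1 mul1mx start subrr.
(* Replacing [A *m V] by the Arnoldi relation leaves a residual along [w], whose size is governed by
   the corner entry of [H ^+ k]. *)
have XS k : X k.+1 = A *m X k + (- K%:C * powdd lam k) *: w.
  have corner : (delta_mx ord_max 0 : 'cV_m.+1) ^t* *m H ^+ k *m delta_mx 0 0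
      = (gam%:C * powdd lam k)%:M.
    rewrite trmx_delta map_delta_mx -rowE -colE; apply/matrixP => i j.
    by rewrite !ord1 !mxE cornerH mulr1n.
  rewrite /X !exprS mulmxBr -!scalemxAr.
  rewrite [A *m (_ *m _)]mulmxA [A *m (_ *m _)]mulmxA AV !mulmxDl scalerDr.
  rewrite -!scalemxAl -[w *m _ *m _]mulmxA -[w *m _ *m _]mulmxA.
  rewrite corner mul_mx_scalar.
  rewrite -[H * _]/(H *m _) -[A * _]/(A *m _) !mulmxA.
  have -> : beta%:C *: (h%:C *: ((gam%:C * powdd lam k) *: w)) =
      (K%:C * powdd lam k) *: w.
    by rewrite !scalerA /K !rmorphM !mulrA.
  by rewrite mulNr scaleNr addrAC addrK.
pose nodes := nseq p 0 ++ lam.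
have re_nodes : [seq complex.Re l | l <- nodes] =
    nseq p 0 ++ [seq complex.Re l | l <- lam].
  by rewrite map_cat map_nseq.
have re_cons0 : 0 :: [seq complex.Re l | l <- nodes] =
    nseq p.+1 0 ++ complex.Re l0 :: [seq complex.Re l | l <- lam0].
  by rewrite re_nodes lam_cons.
(* With [xi = 0] the majorant has to be an antiderivative of the bound on the forcing term, which
   the extra zero node provides. *)
have err_le : norm2 (mxegf (delay p X) t) <=
    egf (fun k => K * powdd (0 :: [seq complex.Re l | l <- nodes]) k) t.
  apply: (@mxegf_norm_le R n A 0 _ (fun k => (- K%:C * powdd nodes k) *: w)
    _ (fun k => K * powdd [seq complex.Re l | l <- nodes] k)); last exact: ltW.
  - move=> u; apply: le_trans (redot_mul_le_log_norm2 A u) _.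
    by rewrite ler_wpM2r ?sqr_ge0.
  - by move=> i j; apply: geom_bounded_delay.
  - move=> i j; apply: geom_bounded_eq
      (geom_boundedZ (- K%:C * w i j) (geom_bounded_powdd nodes)) => k.
    by rewrite mxE mulrAC.
  - exact/geom_boundedZ/geom_bounded_powdd.
  - exact/geom_boundedZ/geom_bounded_powdd.
  - move=> k; rewrite /delay /nodes lam_cons.
    have [lt_kp|le_pk] := ltnP k p.
      rewrite powdd_nseq0_lt // mulr0 scale0r mulmx0 addr0.
      (* At [k.+1 = p] the delayed sequence enters at [X 0], which is zero by [X0]. *)
      have [//|] := ltnP k.+1 p => le_pk1.
      by rewrite (_ : k.+1 = p) ?subnn //; apply/eqP; rewrite eqn_leq lt_kp.
    rewrite ltnNge (leqW le_pk) /= subSn // XS -lam_cons.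
    by rewrite lam_cons -(powdd_nseq0 p) subnK.
  - by move=> k; rewrite powdd_consS mul0r add0r mul0r add0r.
  - rewrite powdd_lt ?mulr0 /=; last first.
      by rewrite size_map size_cat lam_cons addnS.
    rewrite /delay sub0n X0 if_same.
    by rewrite /norm2 big1 ?sqrtr0 // => i _; rewrite mxE expr0n addr0.
  - move=> r r0; rewrite (_ : mxegf _ r = (- K%:C * cegf (powdd nodes) r) *: w).
      rewrite norm2Z norm_w mulr1 normrM normrN.
      rewrite (ger0_norm (x := K%:C)) ?ler0c // egfZ; last exact: geom_bounded_powdd.
      have -> : complex.Re (K%:C * `|cegf (powdd nodes) r|) =
          K * complex.Re `|cegf (powdd nodes) r|.
        by case: `|_| => a b /=; rewrite mul0r subr0.
      by rewrite ler_wpM2l // norm_cegf_powdd_le.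
    apply/matrixP => i j; rewrite !mxE mulrAC -cegfZ; last first.
      exact: geom_bounded_powdd.
    by congr (cegf _ _); apply/funext => k; rewrite mxE mulrAC.
(* The error carries [t ^+ p], the majorant [t ^+ p.+1]; cancelling leaves the factor [t] of the
   bound. *)
have tp_gt0 : 0 < t ^+ p by rewrite exprn_gt0.
move: err_le; rewrite errE norm2Z egfZ; last exact: geom_bounded_powdd.
rewrite re_cons0 egf_powdd_nseq0 -map_cons -lam_cons lamE.
rewrite -divdiff_phi; last first.
  by rewrite -size_eq0 size_map size_tuple.
have -> : complex.Re `|(t ^+ p)%:C| = t ^+ p.
  by rewrite ger0_norm // ler0c ltW.
by rewrite exprSr -(mulrA (t ^+ p)) mulrCA ler_pM2l // !mulrA.
Qed.
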